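(* Let $(E,\rho,[\cdot,\cdot]_E,L)$ be a local almost-Leibniz algebroid over $M$ and let $(g,C,B)$ be an $E$-statistical structure on it. Suppose $\nabla$ and $\nabla^*$ are two admissible linear $E$-connections satisfying, for all $u,v,w\in\mathfrak{X}(E)$, $$2 g(\nabla_u v, w) = 2 g({}^g\widetilde{\nabla}_u v, w) - C(u, v, w),$$ $$2 g(\nabla^*_u v, w) = 2 g({}^g\widetilde{\nabla^*}_u v, w) + C(u, v, w) - g(B(v, w), u) - g(B(u, w), v) + g(B(u, v), w),$$ where ${}^g\widetilde{\nabla}$ and ${}^g\widetilde{\nabla^*}$ are the Levi-Civita connections of $g$ for the brackets $[\cdot,\cdot]_E^{\nabla}$ and $[\cdot,\cdot]_E^{\nabla^*}$ respectively (see context). Then $\nabla$ and $\nabla^*$ are conjugate to each other with respect to $g$ provided that $$B(u, v) = [u, v]_E^{\nabla} - [u, v]_E^{\nabla^*}\quad\text{for all }u,v\in\mathfrak{X}(E).$$ Moreover, $\nabla$ and $\nabla^*$ satisfy $$Q(\nabla, g) = - Q(\nabla^*, g) = - C,\qquad T(\nabla) = 0,\qquad T(\nabla^* ) = B.$$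
   Context: Everything is smooth; $M$ is an orientable, paracompact, Hausdorff smooth manifold, $E\to M$ a real vector bundle, $\mathfrak{X}(E)=\Gamma(E)$, $\Omega^1(E)=\Gamma(E^* )$. An anchored vector bundle $(E,\rho)$ is a vector bundle $E$ with a vector bundle morphism $\rho:E\to T(M)$. A linear $E$-connection is an $\mathbb{R}$-bilinear map $\nabla:\mathfrak{X}(E)\times\mathfrak{X}(E)\to\mathfrak{X}(E)$ with $\nabla_u(fv)=\rho(u)(f)v+f\nabla_u v$ and $\nabla_{fu}v=f\nabla_u v$. An $E$-metric is a symmetric non-degenerate section $g$ of $E^*\otimes E^*$. A local almost-Leibniz algebroid $(E,\rho,[\cdot,\cdot]_E,L)$ is an anchored vector bundle with an $\mathbb{R}$-bilinear bracket $[\cdot,\cdot]_E$ on $\mathfrak{X}(E)$ and a $C^\infty(M,\mathbb{R})$-multilinear map $L:\Omega^1(E)\times\mathfrak{X}(E)\times\mathfrak{X}(E)\to\mathfrak{X}(E)$ with $[u,fv]_E=\rho(u)(f)v+f[u,v]_E$ and $[fu,v]_E=-\rho(v)(f)u+f[u,v]_E+L(Df,u,v)$, where $(Df)(u):=\rho(u)(f)$. For a linear $E$-connection $\nabla$ the modified bracket is $[u,v]_E^{\nabla}:=[u,v]_E-L(e^a,\nabla_{X_a}u,v)$ (sum over $a$), where $(X_a)$ is any local frame of $E$ with dual coframe $(e^a)$. $\nabla$ is admissible if $[u,v]_E+[v,u]_E=L(e^a,\nabla_{X_a}u,v)+L(e^a,\nabla_{X_a}v,u)$ for all $u,v$ (i.e.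 $[\cdot,\cdot]_E^\nabla$ is anti-symmetric). The $E$-torsion is $T(\nabla)(u,v):=\nabla_u v-\nabla_v u-[u,v]_E^{\nabla}$; the $E$-non-metricity is $Q(\nabla,g):=\nabla g$, i.e. $Q(\nabla,g)(u,v,w)=\rho(u)(g(v,w))-g(\nabla_u v,w)-g(v,\nabla_u w)$. $\nabla$ and $\nabla^*$ are conjugate with respect to $g$ if $\rho(u)(g(v,w))=g(\nabla_u v,w)+g(v,\nabla^*_u w)$ for all $u,v,w$. An $E$-statistical structure is a triplet $(g,C,B)$ with $g$ an $E$-metric, $C$ a totally symmetric $(0,3)$-type $E$-tensor (section of $E^*\otimes E^*\otimes E^*$), and $B:\mathfrak{X}(E)\times\mathfrak{X}(E)\to\mathfrak{X}(E)$ an anti-symmetric $C^\infty(M,\mathbb{R})$-bilinear map. For an admissible $\nabla$, $(E,\rho,[\cdot,\cdot]_E^{\nabla})$ is an almost-Lie algebroid (anti-symmetric bracket satisfying the Leibniz rule), and ${}^g\widetilde{\nabla}$ denotes its unique $E$-Levi-Civita connection: the unique linear $E$-connection with ${}^g\widetilde{\nabla} g = 0$ and ${}^g\widetilde{\nabla}_u v-{}^g\widetilde{\nabla}_v u=[u,v]_E^{\nabla}$; equivalently $2g({}^g\widetilde{\nabla}_u v,w)=\rho(u)(g(v,w))+\rho(v)(g(u,w))-\rho(w)(g(u,v))-g([v,w]_E^{\nabla},u)-g([u,w]_E^{\nabla},v)+g([u,v]_E^{\nabla},w)$. Likewise ${}^g\widetilde{\nabla^*}$ is defined with $[\cdot,\cdot]_E^{\nabla^*}$.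 The two displayed equations for $\nabla$ and $\nabla^*$ are implicit (both sides depend on the connections); existence of solutions is assumed.
   Formalization: The sign of C in the last display is corrected: the theorem proves Q(∇,g) = −Q(∇*,g) = +C, because with the given definition of Q and the equation for ∇ the printed value −C is false unless C = 0. *)

(* Defs.v *)
From HB Require Import structures.
From mathcomp Require Import all_boot all_order all_algebra.
From mathcomp Require Import boolp classical_sets functions cardinality reals.
From mathcomp Require Import topology normedtype derive.

Set Implicit Arguments.
Unset Strict Implicit.
Unset Printing Implicit Defensive.
Import Order.TTheory GRing.Theory Num.Theory.
Import numFieldNormedType.Exports.
Local Open Scope classical_set_scope.
Local Open Scope ring_scope.

Section Euclidean.
Variables (R : realType) (n : nat).
Implicit Types (A : set 'rV[R]_n) (f h : 'rV[R]_n -> R).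

Definition partial (i : 'I_n) f : 'rV[R]_n -> R :=
  fun y => 'D_(delta_mx 0 i) f y.

Definition partials (s : seq 'I_n) f : 'rV[R]_n -> R :=
  foldl (fun h i => partial i h) f s.

Definition cont_partial A f :=
  forall y, A y -> {for y, continuous f} /\
                   (forall i, derivable f y (delta_mx 0 i)).

(* C^infinity on the open set A: all iterated partial derivatives exist and are
   continuous.  Only the values of f on A matter when A is open. *)
Definition smooth_dom A f := forall s, cont_partial A (partials s f).

Let kpart k A f := forall s, (size s <= k)%N -> cont_partial A (partials s f).

Let kpart0 k A f : kpart k A f -> cont_partial A f.
Proof. by move=> /(_ [::]); apply. Qed.

Let kpartS k A f : kpart k.+1 A f <->
  cont_partial A f /\ forall i, kpart k A (partial i f).
Proof.
split=> [H|[H0 H] [|i s] sk]; [|exact: H0|exact: (H i s sk)].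
by split=> [|i s sk]; [exact: (H [::])|exact: (H (i :: s))].
Qed.

Let kpartW k A f : kpart k.+1 A f -> kpart k A f.
Proof. by move=> H s sk; apply: H; rewrite leqW. Qed.

Let kpart_ext k A f h : open A -> (forall y, A y -> f y = h y) ->
  kpart k A f -> kpart k A h.
Proof.
move=> oA; have ext1 f' h' : (forall y, A y -> f' y = h' y) ->
    cont_partial A f' -> cont_partial A h'.
  move=> fh H y Ay; have [cf df] := H y Ay.
  have nfh : \forall z \near y, f' z = h' z.
    by apply: filterS (open_nbhs_nbhs (conj oA Ay)) => z; exact: fh.
  split=> [|i]; last by apply: near_eq_derivable (df i).
  rewrite /prop_for /continuous_at -(fh _ Ay).
  exact: cvg_trans (near_eq_cvg nfh) cf.
elim: k f h => [|k IH] f h fh H.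
  by case=> // _; exact: (ext1 _ _ fh (kpart0 H)).
move/kpartS: H => [H0 H]; apply/kpartS; split=> [|i]; first exact: ext1 fh H0.
apply: IH (H i) => y Ay; apply: near_eq_derive => //.
by apply: filterS (open_nbhs_nbhs (conj oA Ay)) => z; exact: fh.
Qed.

Let kpartD k A f h : open A ->
  kpart k A f -> kpart k A h -> kpart k A (f \+ h).
Proof.
move=> oA; have add1 f' h' : cont_partial A f' -> cont_partial A h' ->
    cont_partial A (f' \+ h').
  move=> Hf Hh y Ay; have [cf df] := Hf y Ay; have [ch dh] := Hh y Ay.
  by split=> [|i]; [exact: (cvgD cf ch)|exact: (derivableD (df i) (dh i))].
elim: k f h => [|k IH] f h Hf Hh.
  by case=> // _; exact: add1 (kpart0 Hf) (kpart0 Hh).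
move/kpartS: Hf => [Hf0 Hf]; move/kpartS: Hh => [Hh0 Hh].
apply/kpartS; split=> [|i]; first exact: add1.
apply: kpart_ext (IH _ _ (Hf i) (Hh i)) => // y Ay.
by apply/esym/deriveD; [case: (Hf0 y Ay)|case: (Hh0 y Ay)].
Qed.

Let kpartM k A f h : open A ->
  kpart k A f -> kpart k A h -> kpart k A (f \* h).
Proof.
move=> oA; have mul1 f' h' : cont_partial A f' -> cont_partial A h' ->
    cont_partial A (f' \* h').
  move=> Hf Hh y Ay; have [cf df] := Hf y Ay; have [ch dh] := Hh y Ay.
  by split=> [|i]; [exact: (cvgM cf ch)|exact: (derivableM (df i) (dh i))].
elim: k f h => [|k IH] f h Hf Hh.
  by case=> // _; exact: mul1 (kpart0 Hf) (kpart0 Hh).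
have [Wf Wh] := (kpartW Hf, kpartW Hh).
move/kpartS: Hf => [Hf0 Hf]; move/kpartS: Hh => [Hh0 Hh].
apply/kpartS; split=> [|i]; first exact: mul1.
apply: (@kpart_ext _ _ ((f \* partial i h) \+ (h \* partial i f)) _ oA).
  move=> y Ay; apply/esym; rewrite /partial deriveM //.
  - by case: (Hf0 y Ay).
  - by case: (Hh0 y Ay).
exact: (kpartD oA (IH _ _ Wf (Hh i)) (IH _ _ Wh (Hf i))).
Qed.

Let smooth_kpart A f : smooth_dom A f <-> forall k, kpart k A f.
Proof. by split=> [H k s _|H s]; [exact: H|exact: (H (size s))]. Qed.

Lemma smooth_dom_ext A f h : open A -> (forall y, A y -> f y = h y) ->
  smooth_dom A f -> smooth_dom A h.
Proof.
move=> oA fh /smooth_kpart H; apply/smooth_kpart => k.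
exact: kpart_ext fh (H k).
Qed.

Lemma smooth_domD A f h : open A ->
  smooth_dom A f -> smooth_dom A h -> smooth_dom A (f \+ h).
Proof.
move=> oA /smooth_kpart Hf /smooth_kpart Hh; apply/smooth_kpart => k.
exact: kpartD.
Qed.

Lemma smooth_domM A f h : open A ->
  smooth_dom A f -> smooth_dom A h -> smooth_dom A (f \* h).
Proof.
move=> oA /smooth_kpart Hf /smooth_kpart Hh; apply/smooth_kpart => k.
exact: kpartM.
Qed.

Lemma smooth_dom_cst A (c : R) : smooth_dom A (cst c).
Proof.
move=> s; suff [d ->] : exists d, partials s (cst c) = cst d.
  by move=> y _; split=> [|i]; [exact: cst_continuous|exact: derivable_cst].
elim: s c => [|i s IH] c /=; first by exists c.
suff -> : partial i (cst c) = cst 0 by exact: IH.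
by apply/funext => y; rewrite /partial derive_cst.
Qed.

End Euclidean.

Record chart (R : realType) (n : nat) (M : topologicalType) := Chart {
  chart_dom : set M;
  chart_map :> M -> 'rV[R]_n;
  chart_inv : 'rV[R]_n -> M;
  chart_dom_open : open chart_dom;
  chart_cod_open : open (chart_map @` chart_dom);
  chart_mapK : forall x, chart_dom x -> chart_inv (chart_map x) = x;
  chart_map_cont : forall x, chart_dom x -> {for x, continuous chart_map};
  chart_inv_cont : forall x, chart_dom x ->
    {for chart_map x, continuous chart_inv} }.

Section Atlas.
Variables (R : realType) (n : nat) (M : topologicalType).
Implicit Types (c d : chart R n M) (S : set (chart R n M)).

Definition overlap c d : set 'rV[R]_n := c @` (chart_dom c `&` chart_dom d).

Definition transition c d : 'rV[R]_n -> 'rV[R]_n := d \o chart_inv c.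

Definition smooth_transition c d :=
  forall j : 'I_n, smooth_dom (overlap c d) (fun y => transition c d y 0 j).

Definition charts_cover S := forall x, exists2 c, S c & chart_dom c x.

Definition oriented S := forall c d, S c -> S d ->
  forall y, overlap c d y -> 0 < \det ('J (transition c d) y).

(* An atlas S is orientable if the smooth structure it generates contains an
   oriented atlas, i.e. there is an oriented family of charts covering M, all
   compatible with S. *)
Definition orientable S := exists S', [/\ charts_cover S', oriented S' &
  forall c d, S' c -> S d -> smooth_transition c d /\ smooth_transition d c].

End Atlas.

Definition open_cover (M : topologicalType) (F : set (set M)) :=
  (forall A, F A -> open A) /\ \bigcup_(A in F) A = setT.

Definition paracompact (M : topologicalType) := forall F : set (set M),
  open_cover F -> exists G : set (set M),
  [/\ open_cover G,
      forall A, G A -> exists2 B, F B & A `<=` B &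
      forall x : M, exists2 W, nbhs x W &
        finite_set [set A | G A /\ A `&` W !=set0]].

Record manifold (R : realType) (n : nat) := Manifold {
  manifold_space :> topologicalType;
  atlas : set (chart R n manifold_space);
  atlas_cover : charts_cover atlas;
  atlas_compat : forall c d, atlas c -> atlas d -> smooth_transition c d;
  manifold_hausdorff : hausdorff_space manifold_space;
  manifold_paracompact : paracompact manifold_space;
  manifold_orientable : orientable atlas }.

Section SmoothFunctions.
Variables (R : realType) (n : nat) (M : manifold R n).
Implicit Types (W : set M) (f h : M -> R).

(* meaningful for W open *)
Definition smooth_on W f := forall c, atlas c ->
  smooth_dom (c @` (chart_dom c `&` W)) (f \o chart_inv c).

Lemma chart_open (c : chart R n M) W : open W -> open (c @` (chart_dom c `&` W)).
Proof.
move=> oW; rewrite openE => _ [x [cx Wx] <-].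
have [cc ci] := (chart_cod_open (c := c), chart_inv_cont cx).
have cod : nbhs (c x) (c @` chart_dom c).
  by apply: open_nbhs_nbhs; split=> //; exists x.
have pre : nbhs (c x) (chart_inv c @^-1` W).
  by apply: ci; rewrite chart_mapK//; exact: open_nbhs_nbhs.
apply: filterS2 cod pre => _ [z cz <-] /=; rewrite chart_mapK// => Wz.
by exists z.
Qed.

Lemma smooth_on_ext W f h : open W -> (forall x, W x -> f x = h x) ->
  smooth_on W f -> smooth_on W h.
Proof.
move=> oW fh H c ac; apply: smooth_dom_ext (H c ac); first exact: chart_open.
by move=> _ [x [cx Wx] <-] /=; rewrite chart_mapK//; exact: fh.
Qed.

Lemma smooth_on_cst W (k : R) : smooth_on W (fun=> k).
Proof. by move=> c _; exact: smooth_dom_cst. Qed.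

Lemma smooth_onD W f h : open W ->
  smooth_on W f -> smooth_on W h -> smooth_on W (fun x => f x + h x).
Proof.
by move=> oW Hf Hh c ac; apply: smooth_domD;
  [exact: chart_open|exact: Hf|exact: Hh].
Qed.

Lemma smooth_onM W f h : open W ->
  smooth_on W f -> smooth_on W h -> smooth_on W (fun x => f x * h x).
Proof.
by move=> oW Hf Hh c ac; apply: smooth_domM;
  [exact: chart_open|exact: Hf|exact: Hh].
Qed.

Lemma smooth_onS W W' f : W' `<=` W -> smooth_on W f -> smooth_on W' f.
Proof.
move=> sW H c ac s _ [x [cx Wx] <-]; apply: H => //.
by exists x => //; split=> //; exact: sW.
Qed.

Lemma smooth_on_sum (I : Type) (r : seq I) W (F : I -> M -> R) : open W ->
  (forall i, smooth_on W (F i)) -> smooth_on W (fun x => \sum_(i <- r) F i x).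
Proof.
move=> oW H; elim: r => [|i r IH].
  by under eq_fun do rewrite big_nil; exact: smooth_on_cst.
under eq_fun do rewrite big_cons.
exact: smooth_onD oW (H i) IH.
Qed.

Lemma smooth_on_local f :
  (forall x, exists2 W, W x & smooth_on W f) -> smooth_on setT f.
Proof.
move=> H c ac s _ [x [cx _] <-]; have [W Wx HW] := H x.
by apply: HW => //; exists x.
Qed.

Definition smooth_pred : {pred (M -> R)} := fun f => `[< smooth_on setT f >].

Record smoothFun := SmoothFun {
  sfun :> M -> R;
  sfun_smooth : sfun \in smooth_pred }.

HB.instance Definition _ := [isSub for sfun].
HB.instance Definition _ := [Choice of smoothFun by <:].

Lemma smooth_subring : subring_closed smooth_pred.
Proof.
split.
- by apply/asboolP; exact: smooth_on_cst.
- move=> f h /asboolP Hf /asboolP Hh; apply/asboolP.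
  have HN := smooth_onM openT (@smooth_on_cst setT (-1)) Hh.
  apply: smooth_on_ext openT _ (smooth_onD openT Hf HN) => x _.
  by rewrite mulN1r.
- move=> f h /asboolP Hf /asboolP Hh; apply/asboolP.
  exact: (smooth_onM openT Hf Hh).
Qed.

HB.instance Definition _ :=
  GRing.SubChoice_isSubComPzRing.Build _ _ smoothFun smooth_subring.

Lemma sfunP (f : smoothFun) : smooth_on setT f.
Proof. by apply/asboolP; exact: sfun_smooth. Qed.

Definition mk_smooth f (Hf : smooth_on setT f) : smoothFun :=
  SmoothFun (introT (asboolP _) Hf).

Definition const_fun (k : R) : smoothFun := mk_smooth (@smooth_on_cst setT k).

(* Tangent vectors at x are the derivations at x of the smooth functions. *)
Record tangent (x : M) := Tangent {
  tangent_fun :> smoothFun -> R;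
  tangent_lin : forall (k : R) (f h : smoothFun),
    tangent_fun (const_fun k * f + h) = k * tangent_fun f + tangent_fun h;
  tangent_leibniz : forall f h : smoothFun,
    tangent_fun (f * h) = tangent_fun f * h x + f x * tangent_fun h }.

End SmoothFunctions.

Section Trivialization.
Variables (R : realType) (n : nat) (M : manifold R n).
Variable E : M -> lmodType R.

(* The rank is attached to the trivialization: it is locally constant. *)
Record trivialization := Trivialization {
  triv_dom : set M;
  triv_rank : nat;
  triv_map : forall x, E x -> 'rV[R]_triv_rank;
  triv_inv : forall x, 'rV[R]_triv_rank -> E x;
  triv_dom_open : open triv_dom;
  triv_linear : forall x, triv_dom x -> linear (@triv_map x);
  triv_mapK : forall x, triv_dom x ->
    cancel (@triv_map x) (@triv_inv x);
  triv_invK : forall x, triv_dom x ->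
    cancel (@triv_inv x) (@triv_map x) }.

Definition triv_frame (t : trivialization) (a : 'I_(triv_rank t)) (x : M) : E x :=
  triv_inv (t := t) x (delta_mx 0 a).

Definition triv_coord (t : trivialization) (a : 'I_(triv_rank t)) (x : M)
  (e : E x) : R := triv_map t e 0 a.

End Trivialization.

(* A smooth vector bundle is given by its fibres and by local trivializations
   covering M whose transition matrices are smooth; the smooth structure of the
   total space is the one for which these trivializations are diffeomorphisms. *)
Record vbundle (R : realType) (n : nat) (M : manifold R n) := VBundle {
  fiber :> M -> lmodType R;
  btriv : set (trivialization fiber);
  btriv_cover : forall x, exists2 t, btriv t & triv_dom t x;
  btriv_compat : forall t t', btriv t -> btriv t' ->
    forall (a : 'I_(triv_rank t)) (b : 'I_(triv_rank t')),
    smooth_on (triv_dom t `&` triv_dom t')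
      (fun x => triv_coord b (triv_frame a x)) }.

Section Sections.
Variables (R : realType) (n : nat) (M : manifold R n) (E : vbundle M).

Definition smooth_section (u : forall x, E x) := forall t, btriv t ->
  forall a : 'I_(triv_rank t),
  smooth_on (triv_dom t) (fun x => triv_coord a (u x)).

Record vsection := VSection {
  vsec :> forall x, E x;
  vsec_smooth : smooth_section vsec }.

Lemma smooth_eval_on (t : trivialization E) (h : forall x, E x -> R)
    (u : forall x, E x) :
  (forall x, scalar (h x)) ->
  (forall a : 'I_(triv_rank t),
    smooth_on (triv_dom t) (fun x => h x (triv_frame a x))) ->
  (forall a : 'I_(triv_rank t),
    smooth_on (triv_dom t) (fun x => triv_coord a (u x))) ->
  smooth_on (triv_dom t) (fun x => h x (u x)).
Proof.
move=> hlin Hh Hu; have ot := triv_dom_open t.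
apply: (smooth_on_ext (f := fun x =>
  \sum_a triv_coord a (u x) * h x (triv_frame a x)) ot); last first.
  apply: (@smooth_on_sum _ _ _ _ _ _ (fun a x =>
    triv_coord a (u x) * h x (triv_frame a x))) => // a.
  exact: smooth_onM.
move=> x tx.
pose hx := HB.pack_for {scalar E x} (h x)
  (GRing.isLinear.Build _ _ _ _ _ (hlin x)).
pose m := HB.pack_for {linear E x -> 'rV[R]_(triv_rank t)} (@triv_map _ _ _ _ t x)
  (GRing.isLinear.Build _ _ _ _ _ (triv_linear tx)).
have eu : u x = \sum_(a < triv_rank t) triv_coord a (u x) *: triv_frame a x.
  apply: (can_inj (triv_mapK tx)); rewrite -[RHS]/(m _) linear_sum.
  rewrite [LHS]row_sum_delta; apply: eq_bigr => a _.
  by rewrite linearZ /= /triv_frame triv_invK.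
rewrite [in RHS]eu -[RHS]/(hx _) linear_sum; apply: eq_bigr => a _.
by rewrite linearZ.
Qed.

Lemma vsec_eq (u v : vsection) : (forall x, u x = v x) -> u = v.
Proof.
case: u v => [u Hu] [v Hv] /= uv.
have {}uv : u = v by apply: functional_extensionality_dep.
by subst v; congr VSection; exact: Prop_irrelevance.
Qed.

Lemma smooth_section0 : smooth_section (fun x => 0).
Proof.
move=> t bt a; apply: (smooth_on_ext (triv_dom_open t) _
  (smooth_on_cst 0)) => x tx.
rewrite /triv_coord; have := triv_linear tx (-1) 0 0.
by rewrite scaler0 addr0 scaleN1r addNr => ->; rewrite mxE.
Qed.

Lemma smooth_section_lin (f : smoothFun M) (u v : vsection) :
  smooth_section (fun x => f x *: u x + v x).
Proof.
move=> t bt a; have ot := triv_dom_open t.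
apply: (smooth_on_ext (f := fun x =>
  f x * triv_coord a (u x) + triv_coord a (v x)) ot) => [x tx|].
  by rewrite /triv_coord (triv_linear tx) !mxE.
apply: smooth_onD => //; last exact: vsec_smooth.
apply: smooth_onM => //; last exact: vsec_smooth.
by apply: smooth_onS (sfunP f).
Qed.

Definition vsec0 := VSection smooth_section0.

Lemma smooth_sectionD (u v : vsection) : smooth_section (fun x => u x + v x).
Proof.
have := smooth_section_lin (const_fun M 1) u v.
by congr smooth_section; apply: functional_extensionality_dep => x;
  rewrite scale1r.
Qed.

Lemma smooth_sectionZ (f : smoothFun M) (u : vsection) :
  smooth_section (fun x => f x *: u x).
Proof.
have := smooth_section_lin f u vsec0.
by congr smooth_section; apply: functional_extensionality_dep => x;
  rewrite addr0.
Qed.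

Lemma smooth_sectionN (u : vsection) : smooth_section (fun x => - u x).
Proof.
have := smooth_sectionZ (const_fun M (-1)) u.
by congr smooth_section; apply: functional_extensionality_dep => x;
  rewrite scaleN1r.
Qed.

Definition vsecD u v := VSection (smooth_sectionD u v).
Definition vsecN u := VSection (smooth_sectionN u).
Definition vsecZ f u := VSection (smooth_sectionZ f u).

HB.instance Definition _ := gen_eqMixin vsection.
HB.instance Definition _ := gen_choiceMixin vsection.

Let vsecDA : associative vsecD.
Proof. by move=> u v w; apply: vsec_eq => x /=; rewrite addrA. Qed.
Let vsecDC : commutative vsecD.
Proof. by move=> u v; apply: vsec_eq => x /=; rewrite addrC. Qed.
Let vsec0D : left_id vsec0 vsecD.
Proof. by move=> u; apply: vsec_eq => x /=; rewrite add0r. Qed.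
Let vsecND : left_inverse vsec0 vsecN vsecD.
Proof. by move=> u; apply: vsec_eq => x /=; rewrite addNr. Qed.

HB.instance Definition _ :=
  GRing.isZmodule.Build vsection vsecDA vsecDC vsec0D vsecND.

Let vsecZA f h u : vsecZ f (vsecZ h u) = vsecZ (f * h) u.
Proof. by apply: vsec_eq => x /=; rewrite scalerA. Qed.
Let vsec1Z : left_id 1 vsecZ.
Proof. by move=> u; apply: vsec_eq => x /=; rewrite scale1r. Qed.
Let vsecZDr : right_distributive vsecZ +%R.
Proof. by move=> f u v; apply: vsec_eq => x /=; rewrite scalerDr. Qed.
Let vsecZDl u : {morph vsecZ^~ u : f h / f + h}.
Proof. by move=> f h; apply: vsec_eq => x /=; rewrite scalerDl. Qed.

HB.instance Definition _ := GRing.Zmodule_isLmodule.Build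
  (smoothFun M) vsection vsecZA vsec1Z vsecZDr vsecZDl.

(* A section of the dual bundle, or of a tensor power of it, is a family of
   (multi)linear forms on the fibres with smooth components in the local frames.
   *)
Definition smooth_form (alpha : forall x, E x -> R) := forall t, btriv t ->
  forall a : 'I_(triv_rank t),
  smooth_on (triv_dom t) (fun x => alpha x (triv_frame a x)).

Record oneform := OneForm {
  oneform_fun :> forall x, E x -> R;
  form_linear : forall x, scalar (@oneform_fun x);
  form_smooth : smooth_form oneform_fun }.

Lemma form_eq (alpha beta : oneform) :
  (forall x e, alpha x e = beta x e) -> alpha = beta.
Proof.
case: alpha beta => [a la Ha] [b lb Hb] /= ab.
have {}ab : a = b.
  by apply: functional_extensionality_dep => x; apply/funext => e; exact: ab.
by subst b; congr OneForm; exact: Prop_irrelevance.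
Qed.

Let form_lin_proof (f : smoothFun M) (alpha beta : oneform) :
  (forall x, scalar (fun e : E x => f x * alpha x e + beta x e)) /\
  smooth_form (fun x e => f x * alpha x e + beta x e).
Proof.
split=> [x k v w|t bt a].
  by rewrite !form_linear !mulrDr mulrCA addrACA.
have ot := triv_dom_open t.
apply: smooth_onD => //; last exact: form_smooth.
apply: smooth_onM => //; last exact: form_smooth.
by apply: smooth_onS (sfunP f).
Qed.

Let form0_linear (x : M) : scalar (fun _ : E x => 0 : R).
Proof. by move=> k v w; rewrite mulr0 addr0. Qed.
Let form0_smooth : smooth_form (fun x _ => 0).
Proof. by move=> t bt a; exact: smooth_on_cst. Qed.

Definition form0 := OneForm form0_linear form0_smooth.
Definition form_lin f alpha beta : oneform :=
  OneForm (form_lin_proof f alpha beta).1 (form_lin_proof f alpha beta).2.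
Definition formD alpha beta := form_lin 1 alpha beta.
Definition formZ f alpha := form_lin f alpha form0.
Definition formN alpha := form_lin (-1) alpha form0.

HB.instance Definition _ := gen_eqMixin oneform.
HB.instance Definition _ := gen_choiceMixin oneform.

Let formDA : associative formD.
Proof. by move=> u v w; apply: form_eq => x e /=; rewrite !mul1r addrA. Qed.
Let formDC : commutative formD.
Proof. by move=> u v; apply: form_eq => x e /=; rewrite !mul1r addrC. Qed.
Let form0D : left_id form0 formD.
Proof. by move=> u; apply: form_eq => x e /=; rewrite mul1r add0r. Qed.
Let formND : left_inverse form0 formN formD.
Proof.
by move=> u; apply: form_eq => x e /=; rewrite mul1r addr0 mulN1r addNr.
Qed.

HB.instance Definition _ :=
  GRing.isZmodule.Build oneform formDA formDC form0D formND.

Let formZA f h u : formZ f (formZ h u) = formZ (f * h) u.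
Proof. by apply: form_eq => x e /=; rewrite !addr0 mulrA. Qed.
Let form1Z : left_id 1 formZ.
Proof. by move=> u; apply: form_eq => x e /=; rewrite mul1r addr0. Qed.
Let formZDr : right_distributive formZ +%R.
Proof.
by move=> f u v; apply: form_eq => x e /=; rewrite !addr0 !mul1r mulrDr.
Qed.
Let formZDl u : {morph formZ^~ u : f h / f + h}.
Proof.
by move=> f h; apply: form_eq => x e /=; rewrite !addr0 mul1r mulrDl.
Qed.

HB.instance Definition _ := GRing.Zmodule_isLmodule.Build
  (smoothFun M) oneform formZA form1Z formZDr formZDl.

End Sections.

Section Tensors.
Variables (R : realType) (n : nat) (M : manifold R n) (E : vbundle M).
Local Notation X := (vsection E).

Record emetric := EMetric {
  emetric_fun :> forall x, E x -> E x -> R;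
  emetric_linl : forall x w, scalar (fun e : E x => emetric_fun e w);
  emetric_sym : forall x (e e' : E x), emetric_fun e e' = emetric_fun e' e;
  emetric_nondeg : forall x (e : E x),
    (forall e', emetric_fun e e' = 0) -> e = 0;
  emetric_smooth : forall t, btriv t -> forall a b : 'I_(triv_rank t),
    smooth_on (triv_dom t)
      (fun x => emetric_fun (triv_frame a x) (triv_frame b x)) }.

Record cubic := Cubic {
  cubic_fun :> forall x, E x -> E x -> E x -> R;
  cubic_lin1 : forall x v w, scalar (fun e : E x => cubic_fun e v w);
  cubic_sym12 : forall x (u v w : E x), cubic_fun u v w = cubic_fun v u w;
  cubic_sym23 : forall x (u v w : E x), cubic_fun u v w = cubic_fun u w v;
  cubic_smooth : forall t, btriv t -> forall a b c : 'I_(triv_rank t),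
    smooth_on (triv_dom t)
      (fun x => cubic_fun (triv_frame a x) (triv_frame b x) (triv_frame c x)) }.

Lemma smooth_on_btriv (f : M -> R) :
  (forall t : trivialization E, btriv t -> smooth_on (triv_dom t) f) ->
  smooth_on setT f.
Proof.
move=> H; apply: smooth_on_local => x; have [t bt tx] := btriv_cover E x.
by exists (triv_dom t) => //; exact: H.
Qed.

Lemma form_app_smooth (alpha : oneform E) (u : X) :
  smooth_on setT (fun x => alpha x (u x)).
Proof.
apply: smooth_on_btriv => t bt; apply: (smooth_eval_on (form_linear alpha)).
  by move=> a; exact: form_smooth.
by move=> a; exact: vsec_smooth.
Qed.

Lemma emetric_app_smooth (g : emetric) (u v : X) :
  smooth_on setT (fun x => g x (u x) (v x)).
Proof.
apply: smooth_on_btriv => t bt.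
have linr y (e : E y) : scalar (g y e).
  by move=> k w w'; rewrite emetric_sym emetric_linl !(emetric_sym g e).
apply: (@smooth_eval_on _ _ _ _ t (fun x e => g x e (v x))) => [x|a|a].
- exact: emetric_linl.
- apply: (@smooth_eval_on _ _ _ _ t (fun x e => g x (triv_frame a x) e)).
  + by move=> x; exact: linr.
  + by move=> b; exact: emetric_smooth.
  + by move=> b; exact: vsec_smooth.
- exact: vsec_smooth.
Qed.

Lemma cubic_app_smooth (C : cubic) (u v w : X) :
  smooth_on setT (fun x => C x (u x) (v x) (w x)).
Proof.
apply: smooth_on_btriv => t bt.
have lin2 y (e e' : E y) : scalar (fun z => C y e z e').
  by move=> k z z'; rewrite cubic_sym12 cubic_lin1 !(cubic_sym12 C e).
have lin3 y (e e' : E y) : scalar (fun z => C y e e' z).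
  by move=> k z z'; rewrite cubic_sym23 lin2 !(cubic_sym23 C _ e').
apply: (@smooth_eval_on _ _ _ _ t (fun x e => C x e (v x) (w x))) => [x|a|a].
- exact: cubic_lin1.
- apply: (@smooth_eval_on _ _ _ _ t (fun x e => C x (triv_frame a x) e (w x)))
    => [x|b|b]; [exact: lin2| |exact: vsec_smooth].
  apply: (@smooth_eval_on _ _ _ _ t
    (fun x e => C x (triv_frame a x) (triv_frame b x) e)) => [x|c|c].
  + exact: lin3.
  + exact: cubic_smooth.
  + exact: vsec_smooth.
- exact: vsec_smooth.
Qed.

Definition emetric_app (g : emetric) (u v : X) : smoothFun M :=
  mk_smooth (emetric_app_smooth g u v).

Definition cubic_app (C : cubic) (u v w : X) : smoothFun M :=
  mk_smooth (cubic_app_smooth C u v w).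

End Tensors.

Section Algebroid.
Variables (R : realType) (n : nat) (M : manifold R n) (E : vbundle M).
Local Notation X := (vsection E).
Local Notation Omega := (oneform E).

(* Vector bundle morphism E -> T(M) over the identity.  It is smooth when it
   sends local frames to smooth vector fields, and a vector field is smooth when
   it sends smooth functions to smooth functions. *)
Record anchor := Anchor {
  anchor_fun :> forall x, E x -> tangent x;
  anchor_linear : forall x (f : smoothFun M),
    scalar (fun e : E x => anchor_fun e f);
  anchor_smooth : forall (f : smoothFun M) t, btriv t ->
    forall a : 'I_(triv_rank t),
    smooth_on (triv_dom t) (fun x => anchor_fun (triv_frame a x) f) }.

Definition anchor_diff (rho : anchor) (f : smoothFun M) : Omega :=
  OneForm (fun x => anchor_linear rho (x := x) f) (anchor_smooth rho f).

Definition anchor_act (rho : anchor) (u : X) (f : smoothFun M) : smoothFun M :=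
  mk_smooth (form_app_smooth (anchor_diff rho f) u).

Definition real_linear (F : X -> X) := forall (k : R) (u v : X),
  F (const_fun M k *: u + v) = const_fun M k *: F u + F v.

Definition real_bilinear (F : X -> X -> X) :=
  (forall v, real_linear (F^~ v)) /\ (forall u, real_linear (F u)).

Record algebroid := Algebroid {
  alg_rho : anchor;
  alg_bracket : X -> X -> X;
  alg_L : Omega -> X -> X -> X;
  alg_bracket_bilinear : real_bilinear alg_bracket;
  locality_lin1 : forall u v, linear (fun alpha => alg_L alpha u v);
  locality_lin2 : forall alpha v, linear (fun u => alg_L alpha u v);
  locality_lin3 : forall alpha u, linear (fun v => alg_L alpha u v);
  bracket_leibnizr : forall (f : smoothFun M) (u v : X),
    alg_bracket u (f *: v) = anchor_act alg_rho u f *: v + f *: alg_bracket u v;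
  bracket_leibnizl : forall (f : smoothFun M) (u v : X),
    alg_bracket (f *: u) v = - (anchor_act alg_rho v f *: u)
                             + f *: alg_bracket u v
                             + alg_L (anchor_diff alg_rho f) u v }.

Record connection (r : anchor) := Connection {
  cov :> X -> X -> X;
  cov_bilinear : real_bilinear cov;
  cov_leibniz : forall (f : smoothFun M) (u v : X),
    cov u (f *: v) = anchor_act r u f *: v + f *: cov u v;
  cov_tensor : forall (f : smoothFun M) (u v : X),
    cov (f *: u) v = f *: cov u v }.

(* (X_a) is a local frame over U with dual coframe (e^a).  As brackets,
   connections and locality operators act on global sections, the X_a and e^a
   are global sections whose restrictions to U form a frame and its dual; every
   local frame is of this form near each point of its domain. *)
Definition local_frame (U : set M) k (Xa : 'I_k -> X) (ea : 'I_k -> Omega) :=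
  open U /\ forall x, U x ->
    (forall a b, ea a x (Xa b x) = (a == b)%:R) /\
    (forall w : E x, w = \sum_a ea a x w *: Xa a x).

(* s is the section L(e^a, nabla_{X_a} u, v), summed over a, for any local
   frame. *)
Definition is_frame_sum (A : algebroid) (nabla : X -> X -> X) (u v s : X) :=
  forall U k (Xa : 'I_k -> X) (ea : 'I_k -> Omega), local_frame U Xa ea ->
  forall x, U x -> s x = \sum_a alg_L A (ea a) (nabla (Xa a) u) v x.

(* For a connection nabla there is exactly one such section, by tensoriality of
   nabla and L in the summed arguments. *)
Definition frame_sum (A : algebroid) (nabla : X -> X -> X) (u v : X) : X :=
  xget 0 [set s | is_frame_sum A nabla u v s].

Definition modified_bracket (A : algebroid) (nabla : X -> X -> X)
    (u v : X) : X :=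
  alg_bracket A u v - frame_sum A nabla u v.

Definition admissible (A : algebroid) (nabla : X -> X -> X) := forall u v,
  alg_bracket A u v + alg_bracket A v u =
    frame_sum A nabla u v + frame_sum A nabla v u.

Definition torsion (A : algebroid) (nabla : X -> X -> X) (u v : X) : X :=
  nabla u v - nabla v u - modified_bracket A nabla u v.

(* With this sign, 2 g(nabla_u v, w) = 2 g(lc_u v, w) - C(u, v, w) for the
   Levi-Civita connection lc gives nabla g = + C. *)
Definition nonmetricity (r : anchor) (g : emetric E) (nabla : X -> X -> X)
    (u v w : X) : smoothFun M :=
  anchor_act r u (emetric_app g v w)
  - emetric_app g (nabla u v) w - emetric_app g v (nabla u w).

Definition conjugate (r : anchor) (g : emetric E) (nabla nabla' : X -> X -> X) :=
  forall u v w, anchor_act r u (emetric_app g v w) =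
    emetric_app g (nabla u v) w + emetric_app g v (nabla' u w).

Definition levi_civita (r : anchor) (g : emetric E) (br : X -> X -> X)
    (nabla : connection r) :=
  (forall u v w, nonmetricity r g nabla u v w = 0) /\
  (forall u v, nabla u v - nabla v u = br u v).

Record statistical_structure := StatisticalStructure {
  stat_g : emetric E;
  stat_C : cubic E;
  stat_B : X -> X -> X;
  stat_B_linl : forall v, linear (stat_B^~ v);
  stat_B_linr : forall u, linear (stat_B u);
  stat_B_anti : forall u v, stat_B u v = - stat_B v u }.

End Algebroid.

(* Main.v *)
Require Import Defs.
From HB Require Import structures.
From mathcomp Require Import all_boot all_order all_algebra.
From mathcomp Require Import boolp classical_sets functions cardinality reals.
From mathcomp Require Import topology normedtype derive.
From mathcomp Require Import sequences realfun exp ring lra.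

Set Implicit Arguments.
Unset Strict Implicit.
Unset Printing Implicit Defensive.
Import Order.TTheory GRing.Theory Num.Theory.
Import numFieldNormedType.Exports.
Local Open Scope classical_set_scope.
Local Open Scope ring_scope.

(* The statements about non-metricity are linear combinations of the defining
   equations: the Levi-Civita parts are parallel and C is symmetric.  Conjugacy
   also needs the Koszul formula for both Levi-Civita connections, in which the
   two brackets differ by B.  The torsions are only determined after pairing
   with global sections, and g is non-degenerate only fibrewise; hence every
   vector of a fibre must be the value of a global section.  Such sections are
   constant sections of a local trivialization cut off by bump functions, which
   come from exp(-1/t). *)

(** * Flat functions of one real variable *)

(* All functions of this family are smooth: the derivative of flat k is
   - k flat k.+1 + flat k.+2, also at 0. *)
Definition flat (R : realType) (k : nat) (t : R) : R :=
  if 0 < t then t^-1 ^+ k * expR (- t^-1) else 0.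

Lemma flat_gt0 (R : realType) k (t : R) : 0 < t -> 0 < flat k t.
Proof.
by move=> t0; rewrite /flat t0 mulr_gt0 ?expR_gt0// exprn_gt0// invr_gt0.
Qed.

Lemma flat_ge0 (R : realType) k (t : R) : 0 <= flat k t.
Proof.
case: (ltP 0 t) => [/(flat_gt0 k)/ltW//|t0].
by rewrite /flat ltNge t0.
Qed.

Lemma flatS (R : realType) k (t : R) : flat k t = t * flat k.+1 t.
Proof.
rewrite /flat; case: ifPn => [t0|_]; last by rewrite mulr0.
by rewrite mulrA exprS mulrA divff ?gt_eqF// mul1r.
Qed.

(** With [s = t^-1], the inequality [s / k.+1 <= expR (s / k.+1)] raised to the power [k.+1] bounds
    [s ^+ k.+1] by a multiple of [expR s]. For [s > 1] this also bounds [s ^+ k]; the summand 1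
    covers [s <= 1]. *)
Lemma flat_bounded (R : realType) k (t : R) : flat k t <= k.+1%:R ^+ k.+1 + 1.
Proof.
have K0 : 0 <= k.+1%:R ^+ k.+1 :> R by rewrite exprn_ge0.
rewrite /flat; case: ifPn => [t0|_]; last by rewrite addr_ge0.
set s := t^-1; have s0 : 0 < s by rewrite invr_gt0.
have sK : (s / k.+1%:R) ^+ k.+1 <= expR s.
  have sE : s = k.+1%:R * (s / k.+1%:R) by rewrite mulrC divfK ?pnatr_eq0.
  rewrite [in leRHS]sE expRM_natl.
  rewrite lerXn2r ?nnegrE ?divr_ge0 ?expR_ge0 ?(ltW s0)//.
  by apply: le_trans (expR_ge1Dx _); rewrite lerDr.
rewrite expRN ler_pdivrMr ?expR_gt0//.
have [s1|s1] := leP s 1.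
  apply: (@le_trans _ _ 1); first by rewrite exprn_ile1 // ltW.
  apply: le_trans (_ : 1 * expR s <= _).
    by rewrite mul1r; apply: le_trans (expR_ge1Dx _); rewrite lerDl ltW.
  by rewrite ler_pM2r ?expR_gt0// lerDr.
apply: (@le_trans _ _ (k.+1%:R ^+ k.+1 * expR s)); last first.
  by rewrite ler_pM2r ?expR_gt0// lerDl.
apply: (@le_trans _ _ (s ^+ k.+1)).
  by rewrite exprS ler_peMl ?exprn_ge0 // ltW.
move: sK; rewrite expr_div_n ler_pdivrMr; first by rewrite mulrC.
by rewrite exprn_gt0.
Qed.

Lemma is_derive_flat (R : realType) k (t : R) :
  is_derive t 1 (flat k) (- k%:R * flat k.+1 t + flat k.+2 t).
Proof.
have [t0|t0|t0] := ltgtP t 0.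
- rewrite /flat !(ltNge 0 t) (ltW t0) /= mulr0 addr0.
  apply: near_eq_is_derive (is_derive_cst (0 : R) t 1).
  near=> s; rewrite /cst ltNge ltW //; near: s; exact: lt_nbhsl.
- have tn0 : t != 0 by rewrite gt_eqF.
  apply: (@near_eq_is_derive _ _ _
    ((@GRing.inv R ^+ k) * (expR \o (- @GRing.inv R)))).
    near=> s; rewrite /flat /= ifT; last by near: s; exact: lt_nbhsr.
    by rewrite !fctE.
  have dV := is_deriveV tn0 (is_derive_id t 1).
  have dE := is_derive1_comp (is_derive_expR _) (is_deriveN dV).
  apply: is_derive_eq (is_deriveM (is_deriveX k dV) dE) _.
  rewrite /flat t0 !fctE /= /GRing.scale /=.
  case: k => [|k]; rewrite ?exprS ?expr0 /=; field; exact: tn0.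
- rewrite {}t0 /flat ltxx mulr0 addr0.
  set K : R := (k.+2.+1%:R ^+ k.+2.+1 + 1).
  have K0 : 0 < K by rewrite ltr_wpDl ?exprn_ge0.
  suff H : h^-1 *: ((flat k \o shift 0) (h *: 1) - flat k 0) @[h --> 0^'] --> (0 : R).
    by apply: DeriveDef; [apply/cvg_ex; exists 0|exact: cvg_lim].
  apply/cvgrPdist_lt => e e0; near=> h.
  have h0 : h != 0 by near: h; exact: nbhs_dnbhs_neq.
  rewrite sub0r normrN /= addr0 [_%:A]mulr1 {2}/flat ltxx subr0.
  (* Two factors [h] are extracted: one cancels the division by [h], the other drives the quotient
     to 0 because [flat k.+2] is bounded by [K]. *)
  rewrite flatS flatS.
  rewrite (_ : _ *: _ = h * flat k.+2 h); last by rewrite /GRing.scale /= mulKf.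
  rewrite normrM.
  rewrite (ger0_norm (flat_ge0 _ _)).
  apply: le_lt_trans (_ : `|h| * K < _).
    by rewrite ler_wpM2l // flat_bounded.
  rewrite -ltr_pdivlMr //; near: h; apply: dnbhs0_lt; exact: divr_gt0.
Unshelve. all: by end_near.
Qed.

(** * Smoothness of flat functions composed with smooth functions *)

(** Restriction to a line makes the one-variable chain rule sufficient, so composing with [flat k]
    asks only for a directional derivative of [f]. *)
Lemma is_derive_line (R : realType) (V : normedModType R) (f : V -> R) (y v : V) d :
  is_derive y v f d <-> is_derive (0 : R) 1 (fun h : R => f (h *: v + y)) d.
Proof.
have E : (fun h : R => h^-1 *: ((f \o shift y) (h *: v) - f y)) =
    (fun h : R => h^-1 *: (((fun k : R => f (k *: v + y)) \o shift 0) (h *: 1) -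
      f (0 *: v + y))).
  by apply/funext => h; rewrite /= addr0 scale0r add0r [_%:A]mulr1.
have Ed : 'D_v f y = 'D_1 (fun h : R => f (h *: v + y)) 0.
  by rewrite /derive E.
split=> -[df dE]; apply: DeriveDef.
- exact: (derivable1P f y v).1.
- by rewrite -Ed.
- exact: (derivable1P f y v).2.
- by rewrite Ed.
Qed.

Lemma is_derive_flat_comp (R : realType) (V : normedModType R) (f : V -> R) k
    (y v : V) : derivable f y v ->
  is_derive y v (flat k \o f)
    ((- k%:R * flat k.+1 (f y) + flat k.+2 (f y)) * 'D_v f y).
Proof.
move=> df; apply/is_derive_line.
apply: (@is_derive1_comp _ (flat k) (fun h : R => f (h *: v + y))).
  by rewrite scale0r add0r; exact: is_derive_flat.
by apply/(is_derive_line f); exact: derivableP.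
Qed.

Lemma flat_continuous (R : realType) k : continuous (@flat R k).
Proof.
move=> t; apply: differentiable_continuous; apply/derivable1_diffP.
by have [] := is_derive_flat k t.
Qed.

Lemma cont_partial_ext (R : realType) n (A : set 'rV[R]_n) f h : open A ->
  (forall y, A y -> f y = h y) -> cont_partial A f -> cont_partial A h.
Proof.
move=> oA fh H y Ay; have [cf df] := H y Ay.
have nfh : \forall z \near y, f z = h z.
  by apply: filterS (open_nbhs_nbhs (conj oA Ay)) => z; exact: fh.
split=> [|i]; last by apply: near_eq_derivable (df i).
rewrite /prop_for /continuous_at -(fh _ Ay).
exact: cvg_trans (near_eq_cvg nfh) cf.
Qed.

(* Contains every flat k \o f and is stable under partial derivatives, so its
   members are smooth; extensionality on A is built in because partial only
   makes sense up to equality on the open set A. *)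
Inductive flat_sum (R : realType) n (A : set 'rV[R]_n) (f : 'rV[R]_n -> R) :
    ('rV[R]_n -> R) -> Prop :=
| flat_sum_mul k h of smooth_dom A h :
    flat_sum A f (fun y => flat k (f y) * h y)
| flat_sum_add h1 h2 of flat_sum A f h1 & flat_sum A f h2 :
    flat_sum A f (fun y => h1 y + h2 y)
| flat_sum_ext h1 h2 of (forall y, A y -> h1 y = h2 y) & flat_sum A f h1 :
    flat_sum A f h2.

Lemma flat_sum_cont_partial (R : realType) n (A : set 'rV[R]_n) f h :
  open A -> smooth_dom A f -> flat_sum A f h -> cont_partial A h.
Proof.
move=> oA Hf; elim=> [k {}h Hh|h1 h2 _ H1 _ H2|h1 h2 e _]; last first.
- exact: cont_partial_ext.
- move=> y Ay; have [c1 d1] := H1 y Ay; have [c2 d2] := H2 y Ay.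
  by split=> [|i]; [exact: (cvgD c1 c2)|exact: (derivableD (d1 i) (d2 i))].
- move=> y Ay; have [cf df] := Hf [::] y Ay; have [ch dh] := Hh [::] y Ay.
  split=> [|i].
    apply: (@cvgM _ _ _ _ (flat k \o f) h) ch.
    exact: (continuous_comp cf (@flat_continuous _ _ _)).
  have [dF _] := is_derive_flat_comp k (df i).
  exact: (derivableM dF (dh i)).
Qed.

(** By the Leibniz and chain rules, a generator of index [k] has as partial derivative a sum of
    generators of indices [k], [k.+1] and [k.+2], whose smooth factors are built from [h], [f] and
    their partial derivatives. *)
Lemma flat_sum_partial (R : realType) n (A : set 'rV[R]_n) f h i :
  open A -> smooth_dom A f -> flat_sum A f h -> flat_sum A f (partial i h).
Proof.
move=> oA Hf; elim=> [k {}h Hh|h1 h2 F1 H1 F2 H2|h1 h2 e F1 H1].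
- have Hfi : smooth_dom A (partial i f) by move=> s; exact: (Hf (i :: s)).
  have Hhi : smooth_dom A (partial i h) by move=> s; exact: (Hh (i :: s)).
  have Hp := smooth_domM oA Hfi Hh.
  have Hq := smooth_domM oA (@smooth_dom_cst _ _ A (- k%:R)) Hp.
  apply: (flat_sum_ext _ (flat_sum_add (flat_sum_mul f k Hhi)
    (flat_sum_add (flat_sum_mul f k.+1 Hq) (flat_sum_mul f k.+2 Hp)))) => y Ay.
  have [_ df] := Hf [::] y Ay; have [_ dh] := Hh [::] y Ay.
  have [dF dFE] := is_derive_flat_comp k (df i).
  apply: etrans (esym (deriveM dF (dh i))).
  rewrite dFE; have alg (a b c d p q m : R) :
      a * q + (b * (m * (p * d)) + c * (p * d)) = a * q + d * ((m * b + c) * p).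
    by ring.
  exact: alg.
- apply: (flat_sum_ext _ (flat_sum_add H1 H2)) => y Ay.
  have [_ d1] := flat_sum_cont_partial oA Hf F1 Ay.
  have [_ d2] := flat_sum_cont_partial oA Hf F2 Ay.
  exact: (esym (deriveD (d1 i) (d2 i))).
- apply: flat_sum_ext H1 => y Ay; apply: near_eq_derive => //.
  by apply: filterS (open_nbhs_nbhs (conj oA Ay)) => z; exact: e.
Qed.

Lemma smooth_dom_flat (R : realType) n (A : set 'rV[R]_n) f k :
  open A -> smooth_dom A f -> smooth_dom A (flat k \o f).
Proof.
move=> oA Hf; have : flat_sum A f (flat k \o f).
  apply: flat_sum_ext (flat_sum_mul f k (@smooth_dom_cst _ _ A 1)) => y _.
  by rewrite mulr1.
move=> F s; elim: s (flat k \o f) F => [|i s IH] h F /=.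
  exact: flat_sum_cont_partial F.
exact/IH/flat_sum_partial.
Qed.

(** * Bump functions on the manifold *)

Section Bump.
Variables (R : realType) (n : nat) (M : manifold R n).
Implicit Types (W U K : set M) (f : M -> R).

Lemma smooth_on_locally W f :
  (forall x, W x -> exists2 W', W' x & smooth_on W' f) -> smooth_on W f.
Proof.
move=> H c ac s _ [x [cx Wx] <-]; have [W' W'x HW'] := H x Wx.
by apply: HW' => //; exists x.
Qed.

Lemma smooth_on_flat W f k : open W -> smooth_on W f ->
  smooth_on W (fun x => flat k (f x)).
Proof.
move=> oW Hf c ac; apply: smooth_dom_flat (Hf c ac); exact: chart_open.
Qed.

Lemma chart_coord_smooth (c : chart R n M) j : atlas c ->
  smooth_on (chart_dom c) (fun x => c x 0 j).
Proof. by move=> ac d ad; exact: (atlas_compat ad ac j). Qed.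

(** The Hausdorff axiom makes this compact image closed in all of [M], not only in the chart domain;
    this is what allows extension by 0. *)
Lemma closed_chart_box (c : chart R n M) (Q : set 'rV[R]_n) :
  compact Q -> Q `<=` c @` chart_dom c -> closed (chart_inv c @` Q).
Proof.
move=> cQ Qc; apply: compact_closed; first exact: manifold_hausdorff.
apply: continuous_compact cQ; apply: continuous_in_subspaceT => y /set_mem Qy.
have [x cx <-] := Qc _ Qy; exact: chart_inv_cont.
Qed.

Lemma bump_exists U x : open U -> U x ->
  exists2 f, smooth_on setT f /\ f x != 0 &
  exists K, [/\ closed K, K `<=` U & forall z, ~ K z -> f z = 0].
Proof.
move=> oU Ux; have [c ac cx] := atlas_cover x.
set V := chart_dom c `&` U.
have oV : open V by apply: openI => //; exact: chart_dom_open.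
have oc : open (c @` V) by exact: chart_open.
have cV : (c @` V) (c x) by exists x.
have /nbhs_ballP[e /= e0 eV] : nbhs (c x) (c @` V) by exact: open_nbhs_nbhs.
(* Balls of row vectors are cubes, so halving [e] puts the closed cube [Q] of half-side [r] inside
   the ball of radius [e]. *)
set r := e / 2; have r0 : 0 < r by rewrite divr_gt0.
pose box j := [set` `[c x ord0 j - r, c x ord0 j + r]] : set R.
pose Q := [set v : 'rV[R]_n | forall j, box j (v ord0 j)].
have QV : Q `<=` c @` V.
  move=> v Qv; apply: eV; split=> // i j; rewrite (ord1 i).
  have := Qv j; rewrite /box /= in_itv /= -ler_distl => H.
  rewrite /ball /= distrC; apply: le_lt_trans H _.
  by rewrite ltr_pdivrMr // ltr_pMr // ltr1n.
have cQ : compact Q by apply: rV_compact => j; exact: segment_compact.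
pose K := chart_inv c @` Q.
have KV : K `<=` V.
  by move=> _ [y Qy <-]; have [z [cz Uz] <-] := QV _ Qy; rewrite chart_mapK.
have cK : closed K.
  by apply: closed_chart_box => // y /QV[z [cz _] <-]; exists z.
pose q z := r ^+ 2 - \sum_j (c z 0 j - c x 0 j) ^+ 2.
pose f z := if `[< K z >] then flat 0 (q z) else 0.
(* The cutoff by [K] changes nothing on [V]: if [q z > 0], each coordinate of [c z] is within [r] of
   that of [c x], so [z] lies in [K]. *)
have fV z : V z -> flat 0 (q z) = f z.
  move=> [cz _]; rewrite /f; case: asboolP => // nK.
  rewrite /flat ifF //; apply: contra_notF nK => q0.
  exists (c z); last exact: chart_mapK.
  move=> j; rewrite /box /= in_itv /= -ler_distl -ler_sqr ?nnegrE ?(ltW r0)//.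
  apply: ltW; apply: le_lt_trans (_ : \sum_j (c z 0 j - c x 0 j) ^+ 2 < _).
    by rewrite real_normK ?num_real// (bigD1 j)//= lerDl sumr_ge0// => i _;
      exact: sqr_ge0.
  by rewrite -subr_gt0.
have sV : smooth_on V f.
  apply: (smooth_on_ext oV fV); apply: smooth_on_flat => //.
  have sc j : smooth_on V (fun z => c z 0 j - c x 0 j).
    apply: (smooth_onD oV _ (smooth_on_cst _)).
    by apply: smooth_onS (chart_coord_smooth j ac) => z [].
  have sS := @smooth_on_sum _ _ _ _ (index_enum 'I_n) _
    (fun j z => (c z 0 j - c x 0 j) ^+ 2) oV (fun j => smooth_onM oV (sc j) (sc j)).
  have sN := smooth_onM oV (@smooth_on_cst _ _ _ V (-1)) sS.
  apply: (smooth_on_ext oV _ (smooth_onD oV (@smooth_on_cst _ _ _ V (r ^+ 2)) sN)).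
  by move=> z _; rewrite mulN1r.
have fK z : ~ K z -> f z = 0 by move=> nK; rewrite /f; case: asboolP.
exists f; last by exists K; split=> // z /KV[].
split.
  apply: smooth_on_locally => z _; have [Kz|nKz] := pselect (K z).
    by exists V => //; exact: KV.
  exists (~` K) => //; apply: (smooth_on_ext _ _ (@smooth_on_cst _ _ M (~` K) 0)).
    exact: closed_openC.
  by move=> y /fK ->.
rewrite -fV; last by split.
rewrite gt_eqF// flat_gt0// /q big1 => [|j _]; first by rewrite subr0 exprn_gt0.
by rewrite subrr expr0n.
Qed.

End Bump.

(** * Global sections through a given vector, and non-degeneracy on sections *)

Section NonDegeneracy.
Variables (R : realType) (n : nat) (M : manifold R n) (E : vbundle M).

Lemma triv_inv_linear (t : trivialization E) x : triv_dom t x ->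
  linear (@triv_inv _ _ _ _ t x).
Proof.
move=> tx k u v; apply: (can_inj (triv_mapK tx)).
by rewrite triv_linear// !triv_invK.
Qed.

(** A section with constant coordinates in [t] is a constant combination of the frame of [t], whose
    coordinates in [t'] are smooth by compatibility. *)
Lemma triv_inv_smooth (t t' : trivialization E) v (a : 'I_(triv_rank t')) :
  btriv t -> btriv t' ->
  smooth_on (triv_dom t `&` triv_dom t') (fun x => triv_coord a (triv_inv (t := t) x v : E x)).
Proof.
move=> bt bt'; set W := triv_dom t `&` triv_dom t'.
have oW : open W by apply: openI; exact: triv_dom_open.
have H (b : 'I_(triv_rank t)) := smooth_onM oW
  (@smooth_on_cst _ _ _ W (v 0 b)) (btriv_compat bt bt' b a).
apply: (smooth_on_ext oW _ (@smooth_on_sum _ _ _ _ (index_enum _) W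
  (fun b x => v 0 b * triv_coord a (triv_frame b x)) oW H)).
move=> x [tx tx'].
pose m := HB.pack_for {linear 'rV_(triv_rank t) -> E x} (@triv_inv _ _ _ _ t x)
  (GRing.isLinear.Build _ _ _ _ _ (triv_inv_linear tx)).
pose m' := HB.pack_for {linear E x -> 'rV[R]_(triv_rank t')}
  (@triv_map _ _ _ _ t' x)
  (GRing.isLinear.Build _ _ _ _ _ (triv_linear tx')).
rewrite [in RHS](row_sum_delta v) /triv_coord -[triv_map _ _]/(m' (m _)).
rewrite !linear_sum summxE; apply: eq_bigr => b _.
by rewrite !linearZ mxE.
Qed.

Lemma vsection_through x (e : E x) : exists s : vsection E, s x = e.
Proof.
have [t bt tx] := btriv_cover E x.
have [f [sf fx] [K [cK KU fK]]] := bump_exists (triv_dom_open t) tx.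
(* Dividing by [f x] compensates for the value of the bump function at [x]. *)
pose v := triv_map t ((f x)^-1 *: e).
suff H : smooth_section (fun z => f z *: triv_inv (t := t) z v : E z).
  by exists (VSection H); rewrite /= /v triv_mapK // scalerA divff // scale1r.
move=> t' bt' a; apply: smooth_on_locally => z tz'.
have [tz|ntz] := pselect (triv_dom t z).
  set W := triv_dom t `&` triv_dom t'.
  have oW : open W by apply: openI; exact: triv_dom_open.
  exists W => //; have sfW : smooth_on W f by exact: smooth_onS sf.
  apply: (smooth_on_ext oW _ (smooth_onM oW sfW (triv_inv_smooth v a bt bt'))).
  move=> y [_ ty']; rewrite /triv_coord.
  pose m' := HB.pack_for {linear E y -> 'rV[R]_(triv_rank t')}
    (@triv_map _ _ _ _ t' y)
    (GRing.isLinear.Build _ _ _ _ _ (triv_linear ty')).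
  by rewrite -![triv_map _ _]/(m' _) linearZ mxE.
(* Off the domain of [t] the values of [triv_inv] are arbitrary, but the bump function vanishes on
   this whole neighbourhood. *)
exists (~` K `&` triv_dom t'); first by split=> // /KU.
apply: (smooth_on_ext _ _ (@smooth_on_cst _ _ M _ 0)).
  by apply: openI; [exact: closed_openC|exact: triv_dom_open].
move=> y [/fK -> ty']; rewrite scale0r /triv_coord.
pose m' := HB.pack_for {linear E y -> 'rV[R]_(triv_rank t')}
  (@triv_map _ _ _ _ t' y)
  (GRing.isLinear.Build _ _ _ _ _ (triv_linear ty')).
by rewrite -[triv_map _ _]/(m' _) linear0 mxE.
Qed.

Lemma emetric_app_inj (g : emetric E) (u v : vsection E) :
  (forall w, emetric_app g u w = emetric_app g v w) -> u = v.
Proof.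
move=> uv; apply: vsec_eq => x; apply/eqP; rewrite -subr_eq0; apply/eqP.
apply: (@emetric_nondeg _ _ _ _ g) => e; have [w <-] := vsection_through e.
have /(congr1 (fun f : smoothFun M => f x)) /= E0 := uv w.
rewrite -scaleN1r addrC (emetric_linl g) /= E0.
by rewrite mulN1r addNr.
Qed.

End NonDegeneracy.

(** * The metric on sections and the Koszul formula *)

Section MetricAlgebra.
Variables (R : realType) (n : nat) (M : manifold R n) (E : vbundle M).
Implicit Types (f h : smoothFun M) (u v w : vsection E) (g : emetric E).

Lemma smoothFun_eq f h : (forall x, f x = h x) -> f = h.
Proof. by move=> fh; apply: val_inj; apply/funext. Qed.

(** Smooth functions do not form an integral domain in general, so 2 is cancelled pointwise in
    [R]. *)
Lemma smoothFun_mul2I f h : 2 * f = 2 * h -> f = h.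
Proof.
move=> fh; apply: smoothFun_eq => x.
have : 2 * f x = 2 * h x :> R := congr1 (fun k : smoothFun M => k x) fh.
lra.
Qed.

Lemma emetric_appDl g u v w :
  emetric_app g (u + v) w = emetric_app g u w + emetric_app g v w.
Proof.
apply: smoothFun_eq => x /=.
by have := emetric_linl g (x := x) (w x) 1 (u x) (v x); rewrite scale1r mul1r.
Qed.

Lemma emetric_appC g u v : emetric_app g u v = emetric_app g v u.
Proof. by apply: smoothFun_eq => x /=; rewrite emetric_sym. Qed.

Lemma emetric_appNl g u v : emetric_app g (- u) v = - emetric_app g u v.
Proof.
apply/eqP; rewrite -addr_eq0 -emetric_appDl addNr; apply/eqP.
apply: smoothFun_eq => x /=.
by have := emetric_linl g (x := x) (v x) (-1) 0 0; rewrite scaler0 addr0 mulN1r addNr.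
Qed.

Lemma emetric_appBl g u v w :
  emetric_app g (u - v) w = emetric_app g u w - emetric_app g v w.
Proof. by rewrite emetric_appDl emetric_appNl. Qed.

Lemma levi_civita_koszul (r : anchor E) g br (lc : connection r) :
  levi_civita g br lc -> forall u v w, 2 * emetric_app g (lc u v) w =
    anchor_act r u (emetric_app g v w) + anchor_act r v (emetric_app g u w)
    - anchor_act r w (emetric_app g u v) - emetric_app g (br v w) u
    - emetric_app g (br u w) v + emetric_app g (br u v) w.
Proof.
move=> [parallel tfree] u v w.
(* Differentiated sections are kept in the first slot of [g], so that after substitution the formula
   is a ring identity without further use of symmetry. *)
have P a b c : anchor_act r a (emetric_app g b c) =
    emetric_app g (lc a b) c + emetric_app g (lc a c) b.
  apply/eqP; rewrite -subr_eq0 opprD addrA (emetric_appC g (lc a c)); apply/eqP.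
  exact: parallel.
rewrite -!tfree !emetric_appBl !P; ring.
Qed.

End MetricAlgebra.

Theorem proposition4p5 (R : realType) (n : nat) (M : manifold R n)
  (E : vbundle M) (A : algebroid E) (S : statistical_structure E)
  (nabla nabla' lc lc' : connection (alg_rho A)) :
  let g := emetric_app (stat_g S) in
  let C := cubic_app (stat_C S) in
  let B := stat_B S in
  admissible A nabla ->
  admissible A nabla' ->
  levi_civita (stat_g S) (modified_bracket A nabla) lc ->
  levi_civita (stat_g S) (modified_bracket A nabla') lc' ->
  (forall u v w : vsection E,
    2 * g (nabla u v) w = 2 * g (lc u v) w - C u v w) ->
  (forall u v w : vsection E,
    2 * g (nabla' u v) w = 2 * g (lc' u v) w + C u v w
      - g (B v w) u - g (B u w) v + g (B u v) w) ->
  ((forall u v : vsection E,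
      B u v = modified_bracket A nabla u v - modified_bracket A nabla' u v) ->
    conjugate (alg_rho A) (stat_g S) nabla nabla')
  /\ (forall u v w : vsection E,
       nonmetricity (alg_rho A) (stat_g S) nabla u v w
         = - nonmetricity (alg_rho A) (stat_g S) nabla' u v w
       /\ - nonmetricity (alg_rho A) (stat_g S) nabla' u v w = C u v w)
  /\ (forall u v : vsection E, torsion A nabla u v = 0)
  /\ (forall u v : vsection E, torsion A nabla' u v = B u v).

Proof.
move=> g C B adm adm' lcH lcH' H H'.
have C12 u v w : C u v w = C v u w.
  by apply: smoothFun_eq => x /=; rewrite cubic_sym12.
have C23 u v w : C u v w = C u w v.
  by apply: smoothFun_eq => x /=; rewrite cubic_sym23.
have gB u v w : g (B u v) w = - g (B v u) w.
  by rewrite /B stat_B_anti /g emetric_appNl.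
have tfree u v : modified_bracket A nabla u v = lc u v - lc v u.
  by rewrite lcH.2.
have tfree' u v : modified_bracket A nabla' u v = lc' u v - lc' v u.
  by rewrite lcH'.2.
(* Anti-symmetry of the modified bracket is read off from [lc] being torsion-free. *)
have gbr u v w : g (modified_bracket A nabla u v) w =
    - g (modified_bracket A nabla v u) w.
  by rewrite !tfree /g !emetric_appBl opprB.
have P u v w : anchor_act (alg_rho A) u (g v w) = g (lc u v) w + g v (lc u w).
  by have /eqP := lcH.1 u v w; rewrite subr_eq0 subr_eq addrC => /eqP.
have P' u v w : anchor_act (alg_rho A) u (g v w) = g (lc' u v) w + g v (lc' u w).
  by have /eqP := lcH'.1 u v w; rewrite subr_eq0 subr_eq addrC => /eqP.
have gC u v : g u v = g v u by exact: emetric_appC.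
split; [|split; [|split]].
- move=> HB.
  have gHB u v w : g (B u v) w =
      g (modified_bracket A nabla u v) w - g (modified_bracket A nabla' u v) w.
    by rewrite HB /g emetric_appBl.
  move=> u v w; apply: smoothFun_mul2I.
  (* The Koszul formulas are used at [(u, v, w)] and [(u, w, v)]. The [B] terms turn the brackets of
     [nabla'] into those of [nabla]; anti-symmetry then cancels everything except twice the
     derivative of [g v w] along [u]. *)
  have K := levi_civita_koszul lcH; have K' := levi_civita_koszul lcH'.
  rewrite -/g mulrDr (gC v (nabla' u w)) H H' K K' -/g (C23 u w v) !gHB.
  rewrite (gbr v w) (gC w v); ring.
(* The [B] correction is anti-symmetric in [v] and [w], hence drops out, and [lc'] is parallel; only
   the two equal [C] terms remain. *)
- have Q' u v w : nonmetricity (alg_rho A) (stat_g S) nabla' u v w = - C u v w.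
    apply: smoothFun_mul2I; rewrite /nonmetricity -/g !mulrBr (gC v (nabla' u w)) H' H'.
    rewrite P' (gC v (lc' u w)) (C23 u w v) (gB w v); ring.
  have Q u v w : nonmetricity (alg_rho A) (stat_g S) nabla u v w = C u v w.
    apply: smoothFun_mul2I; rewrite /nonmetricity -/g !mulrBr (gC v (nabla u w)) H H.
    rewrite P (gC v (lc u w)) (C23 u w v); ring.
  by move=> u v w; rewrite Q Q' opprK.
- move=> u v; apply: (@emetric_app_inj _ _ _ _ (stat_g S)) => w; rewrite -/g.
  apply: smoothFun_mul2I.
  rewrite /torsion tfree /g !emetric_appBl -/g !mulrBr !H (C12 v u).
  (* The zero section is written as [u - u] so that bilinearity evaluates its pairing. *)
  rewrite -[0 in RHS](subrr u) /g emetric_appBl -/g; ring.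
(* Under anti-symmetrization in [u] and [v], the [C] terms and the first two [B] terms cancel, while
   the last [B] term doubles. *)
- move=> u v; apply: (@emetric_app_inj _ _ _ _ (stat_g S)) => w; rewrite -/g.
  apply: smoothFun_mul2I.
  rewrite /torsion tfree' /g !emetric_appBl -/g !mulrBr !H' (C12 v u) (gB v u).
  ring.
Qed.
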